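(* Let $\mathbb{F}$ be any field and let $L$ be a nilpotent symplectic alternating algebra over $\mathbb{F}$ of dimension $10$ with an isotropic center of dimension $2$ with the further properties that $L$ is of nilpotence class $6$ and $L^3L^3\nleq Z(L)$. Then $L$ has a presentation of the form $$\mathcal{P}_{10}^{(2,2)}(r):\quad (x_3y_4,y_5)=r,\ (x_2y_3,y_5)=1,\ (x_1y_3,y_4)=1,\ (y_1y_2,y_3)=1,$$ where $r\in\mathbb{F}$, $r\neq 0$. Furthermore the presentations $\mathcal{P}_{10}^{(2,2)}(r)$ and $\mathcal{P}_{10}^{(2,2)}(s)$ (with $r,s\in\mathbb{F}^*$) describe the same algebra if and only if $s/r\in(\mathbb{F}^* )^4$.
   Context: A symplectic alternating algebra (SAA) over a field $\mathbb{F}$ is a finite-dimensional vector space $L$ over $\mathbb{F}$ with a non-degenerate alternating bilinear form $(\ ,\ )$ and a bilinear product $\cdot$ satisfying $u\cdot u=0$ for all $u$ and $(u\cdot v,w)=(v\cdot w,u)$ for all $u,v,w\in L$. No associativity or Jacobi identity is assumed. The map $(u,v,w)\mapsto(uv,w)$ is then an alternating trilinear form. A standard basis (in dimension $10$) is a basis $x_1,y_1,\ldots,x_5,y_5$ with $(x_i,x_j)=(y_i,y_j)=0$ and $(x_i,y_j)=\delta_{ij}$ for all $i,j$. Presentations: $L$ has a presentation if there is a standard basis for which the listed values of triples $(uv,w)$ hold and $(uv,w)=0$ for all triples of basis elements that are not a reordering of a listed one. Two presentations describe the same algebra if the corresponding $10$-dimensional SAA's are isomorphic (by a linear bijection preserving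 product and form). $\mathbb{F}^*=\mathbb{F}\setminus\{0\}$, $(\mathbb{F}^* )^4=\{a^4:a\in\mathbb{F}^*\}$. For subspaces $U,V$, $UV$ is the span of all products $uv$. $L^1=L$, $L^{m+1}=L^mL$. $L$ is nilpotent if $L^{m+1}=\{0\}$ for some $m\ge 0$, and the smallest such $m$ is its (nilpotence) class. The center is $Z(L)=\{x\in L:xL=\{0\}\}$; it is isotropic if $(u,v)=0$ for all $u,v\in Z(L)$. *)

(* Defs.v *)
From HB Require Import structures.
From mathcomp Require Import all_boot all_order all_algebra.

Set Implicit Arguments.
Unset Strict Implicit.
Unset Printing Implicit Defensive.

Import GRing.Theory.
Local Open Scope ring_scope.

(* [sform u v] is the form (u, v); [smul u v] is the product u v, for which
   neither associativity nor the Jacobi identity is assumed. *)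
Record saa (F : fieldType) := SAA {
  saa_sort :> vectType F;
  sform : {biscalar saa_sort};
  smul : {bilinear saa_sort -> saa_sort -> saa_sort};
  sform_alt : forall u, sform u u = 0;
  sform_nondeg : forall u, (forall v, sform u v = 0) -> u = 0;
  smul_alt : forall u, smul u u = 0;
  sform_smul : forall u v w, sform (smul u v) w = sform (smul v w) u
}.

Arguments sform {F L} : rename.
Arguments smul {F L} : rename.

Section Subspaces.
Variables (F : fieldType) (L : saa F).
Implicit Types U V W : {vspace L}.

(* Products of basis vectors suffice to span UV: see [prodsP]. *)
Definition prods U V : {vspace L} :=
  <<[seq smul u v | u <- vbasis U, v <- vbasis V]>>%VS.

Lemma prodsP U V W :
  reflect (forall u v, u \in U -> v \in V -> smul u v \in W)
          (prods U V <= W)%VS.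
Proof.
apply: (iffP span_subvP) => [sW u v uU vV | sW w].
  rewrite (coord_vbasis uU) (coord_vbasis vV) linear_sumlz.
  apply: memv_suml => i _; rewrite linear_sumr; apply: memv_suml => j _.
  rewrite linearZl_LR linearZr_LR !memvZ //; apply: sW.
  by apply/allpairsP; exists ((vbasis U)`_i, (vbasis V)`_j);
    split=> //; apply: mem_nth; rewrite size_tuple.
by case/allpairsP=> -[u v] [/= uU vV ->]; apply: sW; apply: vbasis_mem.
Qed.

(* [lpow m] is L^m, with L^1 = L and L^(m+1) = L^m L; [lpow 0] is a junk
   value equal to L. *)
Definition lpow m : {vspace L} := iter m.-1 (fun U => prods U fullv) fullv.

Definition nilpotent_saa := exists m, lpow m.+1 = 0%VS.

Definition nilpotence_class m :=
  lpow m.+1 = 0%VS /\ forall k, lpow k.+1 = 0%VS -> (m <= k)%N.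

Definition center_saa : {vspace L} :=
  (\bigcap_(y <- vbasis fullv) lker (linfun (applyr smul y)))%VS.

Lemma mem_center_saa x :
  reflect (forall y, smul x y = 0) (x \in center_saa).
Proof.
have -> : (x \in center_saa) = all (fun y => smul x y == 0) (vbasis fullv).
  rewrite /center_saa; elim: (tval _) => [|y s IHs] /=.
    by rewrite big_nil memvf.
  by rewrite big_cons memv_cap IHs memv_ker lfunE.
apply: (iffP allP) => [xZ y | xZ y _]; last by rewrite xZ.
rewrite (coord_vbasis (memvf y)) linear_sumr big1 // => i _.
have /eqP xi0 : smul x (vbasis fullv)`_i == 0.
  by apply: xZ; apply: mem_nth; rewrite size_tuple.
by rewrite linearZr_LR xi0 /= scaler0.
Qed.

Definition isotropic U := forall u v, u \in U -> v \in U -> sform u v = 0.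

End Subspaces.

(* [inl i] and [inr i] index x_(i+1) and y_(i+1) in a standard basis
   x_1, y_1, ..., x_n, y_n; [xg k] and [yg k] use the 1-based numbering. *)
Definition gen n := ('I_n + 'I_n)%type.
Definition xg {n} k : gen n.+1 := inl (inord k.-1).
Definition yg {n} k : gen n.+1 := inr (inord k.-1).

(* The entry [(i, j, k, a)] stands for (b_i b_j, b_k) = a. *)
Definition presentation (F : fieldType) n := seq (gen n * gen n * gen n * F).

Section Presentations.
Variables (F : fieldType) (n : nat).
Implicit Types (L M : saa F) (P Q : presentation F n).

Definition standard_basis L (b : gen n -> L) :=
  basis_of fullv (codom b) /\
  forall i j, [/\ sform (b (inl i)) (b (inl j)) = 0,
                  sform (b (inr i)) (b (inr j)) = 0
                & sform (b (inl i)) (b (inr j)) = (i == j)%:R].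

Definition listed P (i j k : gen n) :=
  has (fun e => perm_eq [:: i; j; k] [:: e.1.1.1; e.1.1.2; e.1.2]) P.

Definition satisfies L (b : gen n -> L) P :=
  (forall i j k a, (i, j, k, a) \in P -> sform (smul (b i) (b j)) (b k) = a) /\
  (forall i j k, ~~ listed P i j k -> sform (smul (b i) (b j)) (b k) = 0).

Definition has_presentation L P :=
  exists b : gen n -> L, standard_basis b /\ satisfies b P.

End Presentations.

Definition isomorphic_saa (F : fieldType) (L M : saa F) :=
  exists f : {linear L -> M},
    [/\ bijective f,
        forall u v, f (smul u v) = smul (f u) (f v)
      & forall u v, sform (f u) (f v) = sform u v].

Section Uniqueness.
Variables (F : fieldType) (n : nat).
Implicit Types (L M : saa F) (P Q : presentation F n).

Lemma sformC L (u v : L) : sform u v = - sform v u.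
Proof.
apply/eqP; rewrite -addr_eq0; have := sform_alt (u + v).
by rewrite !(linearDl, linearDr) /= !sform_alt add0r addr0 => /eqP.
Qed.

Lemma smulC L (u v : L) : smul u v = - smul v u.
Proof.
apply/eqP; rewrite -addr_eq0; have := smul_alt (u + v).
by rewrite !(linearDl, linearDr) /= !smul_alt add0r addr0 => /eqP.
Qed.

Definition crd L (b : gen n -> L) (u : L) (k : gen n) : F :=
  match k with
  | inl i => sform u (b (inr i))
  | inr i => - sform u (b (inl i))
  end.

Lemma sform_basis_eq L (b : gen n -> L) (u v : L) : standard_basis b ->
  (forall k, sform u (b k) = sform v (b k)) -> u = v.
Proof.
move=> [/andP[/eqP bL _] _] uv; apply/eqP; rewrite -subr_eq0; apply/eqP.
apply: sform_nondeg => w; have /coord_span -> : w \in <<codom_tuple b>>%VS.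
  by rewrite bL memvf.
rewrite linear_sumr big1 // => i _; rewrite linearZr_LR /=.
suff -> : sform (u - v) (codom b)`_i = 0 by rewrite mulr0.
have /codomP[k ->] : (codom b)`_i \in codom b.
  by apply: mem_nth; rewrite size_codom.
by rewrite linearBl /= uv subrr.
Qed.

Lemma sform_crd L (b : gen n -> L) (c : gen n -> F) k : standard_basis b ->
  sform (\sum_j c j *: b j) (b k) =
    match k with inl i => - c (inr i) | inr i => c (inl i) end.
Proof.
move=> [_ bE]; rewrite linear_sumlz big_sumType /=.
have D i j : (i == j :> 'I_n)%:R = if j == i then 1 else 0 :> F.
  by rewrite eq_sym; case: eqP.
case: k => k.
  rewrite big1 ?add0r => [|i _]; last first.
    by rewrite linearZl_LR; have [-> _ _] := bE i k; rewrite /= mulr0.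
  rewrite (bigD1 k) //= big1 ?addr0 => [|i ik].
    by rewrite linearZl_LR sformC; have [_ _ ->] := bE k k; rewrite /= eqxx mulrN1.
  rewrite linearZl_LR sformC; have [_ _ ->] := bE k i.
  by rewrite /= eq_sym (negPf ik) oppr0 mulr0.
rewrite addrC big1 ?add0r => [|i _]; last first.
  by rewrite linearZl_LR; have [_ -> _] := bE i k; rewrite /= mulr0.
rewrite (bigD1 k) //= big1 ?addr0 => [|i ik].
  by rewrite linearZl_LR; have [_ _ ->] := bE k k; rewrite /= eqxx mulr1.
by rewrite linearZl_LR; have [_ _ ->] := bE i k; rewrite /= (negPf ik) mulr0.
Qed.

Lemma crdK L (b : gen n -> L) u : standard_basis b ->
  \sum_k crd b u k *: b k = u.
Proof.
move=> bS; apply: (sform_basis_eq bS) => k; rewrite sform_crd //.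
by case: k => i /=; rewrite ?opprK.
Qed.

Lemma satisfies_eq L M (b : gen n -> L) (c : gen n -> M) P i j k :
  satisfies b P -> satisfies c P ->
  sform (smul (b i) (b j)) (b k) = sform (smul (c i) (c j)) (c k).
Proof.
move=> [b1 b0] [c1 c0]; case: (boolP (listed P i j k)) => [|nP]; last first.
  by rewrite b0 // c0.
have cyc L' (u v w : L') : sform (smul u v) w = sform (smul v w) u.
  exact: sform_smul.
have swp L' (u v w : L') : sform (smul u v) w = - sform (smul v u) w.
  by rewrite smulC linearNl.
case/hasP=> -[[[p q] r] a] eP /=; rewrite perm_sym.
have E1 : sform (smul (b p) (b q)) (b r) = sform (smul (c p) (c q)) (c r).
  by rewrite (b1 _ _ _ _ eP) (c1 _ _ _ _ eP).
have E2 : sform (smul (b q) (b r)) (b p) = sform (smul (c q) (c r)) (c p).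
  by rewrite -(cyc L) -(cyc M).
have E3 : sform (smul (b r) (b p)) (b q) = sform (smul (c r) (c p)) (c q).
  by rewrite (cyc L) (cyc M).
have two x y x' y' : perm_eq [:: x; y] [:: x'; y'] ->
    (x = x' /\ y = y') \/ (x = y' /\ y = x' :> gen n).
  case/perm_consP=> -[|[|m]] [u] [] /=; rewrite /rot /= => -[-> <-].
  - by move/perm_small_eq=> /(_ isT) [->]; left.
  - by move/perm_small_eq=> /(_ isT) [->]; right.
  - by move/perm_small_eq=> /(_ isT) [->]; left.
case/perm_consP=> -[|[|[|m]]] [u] [] /=; rewrite /rot /= => -[<- <-] /two;
  case=> -[<- <-] //; by rewrite (swp L) (swp M) ?E1 ?E2 ?E3.
Qed.

Lemma smul_sum L (b : gen n -> L) (x y : gen n -> F) w :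
  sform (smul (\sum_i x i *: b i) (\sum_j y j *: b j)) w =
  \sum_i \sum_j x i * (y j * sform (smul (b i) (b j)) w).
Proof.
rewrite linear_sumlz linear_sumlz; apply: eq_bigr => i _.
rewrite linear_sumr linear_sumlz; apply: eq_bigr => j _.
by rewrite linearZl_LR linearZr_LR /= 2!linearZl_LR.
Qed.

Lemma has_presentation_unique L M P :
  has_presentation L P -> has_presentation M P -> isomorphic_saa L M.
Proof.
move=> [b [bS bP]] [c [cS cP]].
pose tr L1 L2 (b1 : gen n -> L1) (b2 : gen n -> L2) u :=
  \sum_k crd b1 u k *: b2 k.
have trP L1 L2 (b1 : gen n -> L1) (b2 : gen n -> L2) : linear (tr L1 L2 b1 b2).
  move=> a u v; rewrite /tr scaler_sumr -big_split; apply: eq_bigr => k _ /=.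
  rewrite scalerA -scalerDl; congr (_ *: _).
  by case: k => k /=; rewrite linearPl //= opprD mulrN.
have sform_tr L1 L2 (b1 : gen n -> L1) (b2 : gen n -> L2) u k :
    standard_basis b2 -> sform (tr L1 L2 b1 b2 u) (b2 k) = sform u (b1 k).
  by move=> S2; rewrite sform_crd //; case: k => k /=; rewrite ?opprK.
have trK L1 L2 (b1 : gen n -> L1) (b2 : gen n -> L2) :
    standard_basis b1 -> standard_basis b2 ->
    cancel (tr L1 L2 b1 b2) (tr L2 L1 b2 b1).
  by move=> S1 S2 u; apply: (sform_basis_eq S1) => k; rewrite !sform_tr.
pose fP := GRing.isLinear.Build _ _ _ _ (tr L M b c) (trP _ _ b c).
pose f : {linear L -> M} := HB.pack (tr L M b c) fP.
exists f; split.
- by exists (tr M L c b); apply: trK.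
- move=> u v; apply: (sform_basis_eq cS) => k; rewrite /= sform_tr //.
  rewrite -[in LHS](crdK u bS) -[in LHS](crdK v bS) !smul_sum.
  apply: eq_bigr => i _; apply: eq_bigr => l _.
  by rewrite (satisfies_eq _ _ _ bP cP).
- move=> u v /=; rewrite -{2}(crdK v bS) {2}/tr !linear_sumr.
  by apply: eq_bigr => k _; rewrite !linearZr_LR /= sform_tr.
Qed.

End Uniqueness.

(* By [has_presentation_unique] it does not matter which algebras with the
   presentations P and Q are compared. *)
Definition same_algebra (F : fieldType) n (P Q : presentation F n) :=
  exists L M : saa F,
    [/\ has_presentation L P, has_presentation M Q & isomorphic_saa L M].

Definition P10_22 (F : fieldType) (r : F) : presentation F 5 :=
  [:: (xg 3, yg 4, yg 5, r);
      (xg 2, yg 3, yg 5, 1);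
      (xg 1, yg 3, yg 4, 1);
      (yg 1, yg 2, yg 3, 1)].

(* Main.v *)
Require Import Defs.
From HB Require Import structures.
From mathcomp Require Import all_boot all_order all_algebra.
From mathcomp Require Import ring.

(** Write T(u, v, w) = (uv, w), an alternating trilinear form, and L^i for the
    lower central series.

    Existence.  The identity (uw, v) = (wv, u) moves one step of the lower
    central series from one side of the form to the other, so L^7 = 0 gives
    (L^i, L^j) = 0 whenever i + j >= 8 ([lpow_orth]); hence T vanishes on
    L^4 x L^3 x L.  The center is the orthogonal of L^2, so dim Z(L) = 2 means
    that L is spanned modulo L^2 by two elements p, q.  With c = pq it follows
    that L^2 = Fc + L^3 and L^3 = F cp + F cq + L^4, and therefore that
    t = T(cp, cq, c) is nonzero, because L^3L^3 is not central
    ([gen_tri_neq0]).  Up to scalars, y4 = p and y5 = q determine every other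
    vector of the desired basis as a product: y3 ~ y4y5, y1 = y4y3, y2 = y5y3,
    x1 = y2y3, x2 = y3y1, x3 = y1y2, x4 ~ x3y5, x5 ~ x3y4.  Almost all values of
    the form and of T on these vectors are forced by T being alternating and by
    the vanishing above; the remaining conditions are (p, q) = 0, (cp, cq) = 0,
    T(cp, cq, p) = T(cp, cq, q) = 0 ([presentation_of_generators]).  They are
    reached by successive translations: p and q by multiples of c
    ([adjust_gen_tri]), then p by a multiple of cp ([adjust_orth]), then p by a
    central element ([adjust_form]); each of them leaves the conditions already
    reached and t untouched, because T(cp, cq, -) depends on p and q modulo L^2
    only ([gen_tri_shift]).  Finally p is divided by t, which makes
    T(y1, y2, y3) = 1 without extracting any root, and r = - 1 / t.

    Classification.  Replacing (p, q) by other elements whose coordinates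
    modulo L^2 have determinant D multiplies t by D^4.  In the algebra with
    parameter r the pair (y4, y5) gives t = - r^3, so an isomorphism from the
    algebra with parameter r to the one with parameter s yields
    r^3 = s^3 D^4, that is, s / r = (D s / r)^4.  This is computed in an
    explicit coordinate algebra ([model]), which also shows that each
    presentation of the family is realised.  Conversely a diagonal change of
    basis multiplies r by any prescribed nonzero fourth power
    ([has_presentation_rescale]). *)

Set Implicit Arguments.
Unset Strict Implicit.
Unset Printing Implicit Defensive.

Import GRing.Theory.
Local Open Scope ring_scope.

Local Notation "u ** v" := (smul u v) (at level 40, left associativity).

(** * The form and the associated alternating trilinear form *)

Section Calculus.
Variables (F : fieldType) (L : saa F).
Implicit Types (a : F) (u v w : L).

Lemma sformDl u v w : sform (u + v) w = sform u w + sform v w.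
Proof. exact: linearDl. Qed.
Lemma sformDr u v w : sform u (v + w) = sform u v + sform u w.
Proof. exact: linearDr. Qed.
Lemma sformZl a u v : sform (a *: u) v = a * sform u v.
Proof. exact: linearZl_LR. Qed.
Lemma sformZr a u v : sform u (a *: v) = a * sform u v.
Proof. exact: linearZr_LR. Qed.
Lemma sformNl u v : sform (- u) v = - sform u v.
Proof. exact: linearNl. Qed.
Lemma sformNr u v : sform u (- v) = - sform u v.
Proof. exact: linearNr. Qed.
Lemma sform0l u : sform 0 u = 0.
Proof. exact: linear0l. Qed.
Lemma sform0r u : sform u 0 = 0.
Proof. exact: linear0r. Qed.
Definition sformE := (sformDl, sformDr, sformNl, sformNr, sformZl, sformZr,
  sform0l, sform0r).

Lemma smulDl u v w : (u + v) ** w = u ** w + v ** w.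
Proof. exact: linearDl. Qed.
Lemma smulDr u v w : u ** (v + w) = u ** v + u ** w.
Proof. exact: linearDr. Qed.
Lemma smulZl a u v : (a *: u) ** v = a *: (u ** v).
Proof. exact: linearZl_LR. Qed.
Lemma smulZr a u v : u ** (a *: v) = a *: (u ** v).
Proof. exact: linearZr_LR. Qed.
Lemma smulNl u v : (- u) ** v = - (u ** v).
Proof. exact: linearNl. Qed.
Lemma smulNr u v : u ** (- v) = - (u ** v).
Proof. exact: linearNr. Qed.
Definition smulE := (smulDl, smulDr, smulNl, smulNr, smulZl, smulZr).

Lemma tri_swap12 u v w : sform (u ** v) w = - sform (v ** u) w.
Proof. by rewrite smulC sformNl. Qed.

Lemma tri_swap23 u v w : sform (u ** v) w = - sform (u ** w) v.
Proof. by rewrite sform_smul tri_swap12 sform_smul sform_smul. Qed.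

Lemma tri_diag12 u w : sform (u ** u) w = 0.
Proof. by rewrite smul_alt sform0l. Qed.

Lemma tri_diag23 u v : sform (u ** v) v = 0.
Proof. by rewrite sform_smul tri_diag12. Qed.

Lemma tri_diag13 u v : sform (u ** v) u = 0.
Proof. by rewrite tri_swap12 tri_diag23 oppr0. Qed.

Lemma sform_ext v : (forall w, sform w v = 0) -> v = 0.
Proof. by move=> v0; apply: sform_nondeg => w; rewrite sformC v0 oppr0. Qed.

(** Pairing with a basis is an injective linear map from [L] to row vectors of
    length [\dim L], by non-degeneracy, hence it is onto. *)
Lemma sform_riesz (phi : L -> F) : scalar phi ->
  exists u, forall v, sform u v = phi v.
Proof.
move=> phiL; pose e := vbasis {:L}.
have eL v : v = \sum_i coord e i v *: e`_i by apply: coord_vbasis; apply: memvf.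
pose S u : 'rV[F]_(\dim {:L}) := \row_j sform u e`_j.
have SL : linear S.
  by move=> a u v; apply/rowP=> j; rewrite !mxE sformDl sformZl.
pose SP := GRing.isLinear.Build _ _ _ _ S SL.
pose f := linfun (HB.pack S SP : {linear L -> 'rV[F]_(\dim {:L})}).
have fE u : f u = S u by rewrite lfunE.
have f0 : lker f == 0%VS.
  apply/lker0P => u v; rewrite !fE => /rowP uv.
  apply/eqP; rewrite -subr_eq0; apply/eqP; apply: sform_nondeg => w.
  rewrite (eL w) linear_sumr big1 // => j _; rewrite sformZr sformDl sformNl.
  by have := uv j; rewrite !mxE => ->; rewrite subrr mulr0.
have fT : limg f = fullv.
  apply/eqP; rewrite eqEdim subvf limg_dim_eq; last by rewrite capfv; apply/eqP.
  by rewrite dimvf /dim /= mul1n.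
have /memv_imgP[u _ uE] : \row_j phi e`_j \in limg f by rewrite fT memvf.
exists u => v; pose psi : {scalar L} := HB.pack phi
  (GRing.isLinear.Build _ _ _ _ phi phiL).
rewrite -[phi v]/(psi v) (eL v) !linear_sum; apply: eq_bigr => j _.
rewrite !linearZ /=; congr (_ * _).
by move/rowP: uE => /(_ j); rewrite fE !mxE.
Qed.

(** The functional [v |-> (w, v - projv U v)] kills [U]; it is nonzero at the
    given vector for a suitable [w], and it is represented by some [x]. *)
Lemma sform_separates (U : {vspace L}) v : v \notin U ->
  exists2 x, (forall u, u \in U -> sform x u = 0) & sform x v = 1.
Proof.
move=> vU; pose w0 := v - projv U v.
have w0N : w0 != 0.
  by apply: contra vU; rewrite subr_eq0 => /eqP ->; apply: memv_proj.
have [j wj] : exists j, sform (vbasis {:L})`_j w0 != 0.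
  case: (pickP (fun j : 'I_(\dim {:L}) => sform (vbasis {:L})`_j w0 != 0)).
    by move=> j jP; exists j.
  move=> noj; case/eqP: w0N; apply: sform_ext => w.
  rewrite (coord_vbasis (memvf w)).
  rewrite linear_sumlz big1 // => j _; rewrite sformZl.
  by have /eqP -> := negbFE (noj j); rewrite mulr0.
set w := (_`_j) in wj.
have [|x xE] :=
  @sform_riesz (fun u => (sform w w0)^-1 * sform w (u - projv U u)).
  move=> a u1 u2; rewrite linearP /= !sformE; ring.
exists x => [u uU|]; rewrite xE; last by rewrite mulVf.
by rewrite projv_id // subrr sform0r mulr0.
Qed.

End Calculus.

(** * Orthogonality in the lower central series *)

Section LowerCentralSeries.
Variables (F : fieldType) (L : saa F).
Implicit Types (a : F) (u v w : L).

Lemma prods_orth (U V : {vspace L}) w :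
  (forall u v, u \in U -> v \in V -> sform w (u ** v) = 0) ->
  forall x, x \in prods U V -> sform w x = 0.
Proof.
move=> wUV x; rewrite /prods; set s := (X in <<X>>%VS) => xs.
rewrite (coord_span (X := in_tuple s) xs).
rewrite linear_sumr big1 // => i _; rewrite sformZr.
have /allpairsP[[u v] [/= uU vV ->]] : s`_i \in s by apply: mem_nth.
by rewrite wUV ?mulr0 ?vbasis_mem.
Qed.

Lemma lpow_mul i u v : u \in lpow L i.+1 -> u ** v \in lpow L i.+2.
Proof.
by move=> uL; have /prodsP := subvv (lpow L i.+2); apply; rewrite ?memvf.
Qed.

Lemma lpow_mulr i u v : v \in lpow L i.+1 -> u ** v \in lpow L i.+2.
Proof. by move=> vL; rewrite smulC rpredN lpow_mul. Qed.

Lemma mul_lpow2 u v : u ** v \in lpow L 2.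
Proof. by rewrite lpow_mul ?memvf. Qed.

Lemma mul_mul_lpow3 p q w : p ** q ** w \in lpow L 3.
Proof. by rewrite !lpow_mul ?memvf. Qed.

Lemma lpow_decr i u : u \in lpow L i.+2 -> u \in lpow L i.+1.
Proof.
elim: i u => [|i IH] u; first by rewrite memvf.
by move: u; apply/subvP; apply/prodsP => u v uL _; apply: lpow_mul; apply: IH.
Qed.

(** Since [(u w, v) = (w v, u)], the spaces L^(i+2) and L^(j+1) are orthogonal
    as soon as L^(i+1) and L^(j+2) are, and L^1 is orthogonal to L^(m+1) = 0. *)
Lemma lpow_orth m i j u v : lpow L m.+1 = 0%VS -> (i + j)%N = m ->
  u \in lpow L i.+1 -> v \in lpow L j.+1 -> sform u v = 0.
Proof.
move=> L0; elim: i j u v => [|i IH] j u v.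
  by rewrite add0n => -> _; rewrite L0 memv0 => /eqP ->; rewrite sform0r.
rewrite addSnnS => ij uL vL; rewrite sformC; apply/eqP; rewrite oppr_eq0.
apply/eqP; apply: (prods_orth _ uL) => u1 w u1L _.
by rewrite sformC sform_smul sformC (IH j.+1) ?oppr0 // lpow_mulr.
Qed.

(** The center is the orthogonal of L^2, because [(z y, w) = (y w, z)]. *)
Lemma mem_center_orth z :
  z \in center_saa L <-> (forall v, v \in lpow L 2 -> sform z v = 0).
Proof.
split=> [/mem_center_saa zZ | zL].
  apply: prods_orth => u v _ _.
  by rewrite sformC -sform_smul zZ sform0l oppr0.
apply/mem_center_saa => y; apply: sform_nondeg => w.
by rewrite sform_smul sformC zL ?oppr0 // lpow_mul ?memvf.
Qed.

(** The other half of the duality between the center and L^2: L^2 is its own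
    double orthogonal. *)
Lemma mem_lpow2_orth v :
  (forall z, z \in center_saa L -> sform z v = 0) -> v \in lpow L 2.
Proof.
move=> vZ; apply: contraT => /sform_separates[x xL xv].
have /mem_center_orth/vZ : forall v, v \in lpow L 2 -> sform x v = 0 by [].
by rewrite xv => /eqP; rewrite oner_eq0.
Qed.

End LowerCentralSeries.

(** * Two generators modulo L^2 *)

Section Generators.
Variables (F : fieldType) (L : saa F).
Implicit Types (a b : F) (p q u v w : L).

(** Spanning modulo L^2 is what makes a pair generate a nilpotent algebra,
    whence the name. *)
Definition generators p q := forall v,
  exists a b l, l \in lpow L 2 /\ v = a *: p + b *: q + l.

Lemma generators_shift p q u v : u \in lpow L 2 -> v \in lpow L 2 ->
  generators p q -> generators (p + u) (q + v).
Proof.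
move=> uL vL gpq w; have [a [b [l [lL ->]]]] := gpq w.
exists a, b, (l - (a *: u + b *: v)); split.
  by rewrite !(rpredB, rpredD, rpredZ).
rewrite !scalerDr (addrACA (a *: p) (a *: u)) -[RHS]addrA; congr (_ + _).
by rewrite addrC subrK.
Qed.

(** The form pairs [L / L^2] perfectly with the center, so the dual family of a
    basis of the center spans [L] modulo L^2. *)
Lemma center_generators : \dim (center_saa L) = 2%N ->
  exists p q, generators p q.
Proof.
move=> dZ; pose e : seq L := vbasis (center_saa L).
pose z1 := e`_0; pose z2 := e`_1.
have se : size e = 2%N by rewrite size_tuple.
have eE : e = [:: z1; z2].
  have two (s : seq L) : size s = 2%N -> s = [:: s`_0; s`_1].
    by case: s => [|x [|y []]].
  exact: two.
have [z1Z z2Z] : z1 \in center_saa L /\ z2 \in center_saa L.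
  by split; apply: vbasis_mem; apply: mem_nth; rewrite -/e se.
have ZE z : z \in center_saa L -> exists a b, z = a *: z1 + b *: z2.
  have -> : center_saa L = <<e>>%VS by rewrite (span_basis (vbasisP _)).
  rewrite eE span_cons span_seq1.
  by case/memv_addP=> _ /vlineP[a ->] [_ /vlineP[b ->] ->]; exists a, b.
have := basis_free (vbasisP (center_saa L)); rewrite -/e eE.
have dual (x y : L) : free [:: x; y] ->
    exists2 p, sform x p = 1 & sform y p = 0.
  rewrite free_cons span_seq1 => /andP[/sform_separates[p py px] _].
  exists (- p); first by rewrite sformNr -sformC.
  by rewrite sformNr -sformC py // memv_line.
move=> fz; have [p p1 p2] := dual _ _ fz.
have [q q2 q1] : exists2 q, sform z2 q = 1 & sform z1 q = 0.
  apply: dual; rewrite (perm_free (_ : perm_eq _ [:: z1; z2])) //.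
  by rewrite (perm_catC [:: z2]).
exists p, q => v; exists (sform z1 v), (sform z2 v).
exists (v - (sform z1 v *: p + sform z2 v *: q)); split.
  apply: mem_lpow2_orth => z /ZE[a [b ->]].
  by rewrite !sformE p1 p2 q1 q2; ring.
by rewrite addrC subrK.
Qed.

Section Layers.
Variables p q : L.
Hypothesis gpq : generators p q.

Local Notation c := (p ** q).

(** The product being alternating, modulo L^3 it only sees the determinant of
    the coordinates of its two factors on [p], [q]. *)
Lemma generators_lpow2 v : v \in lpow L 2 ->
  exists a l, l \in lpow L 3 /\ v = a *: c + l.
Proof.
suff LE : (lpow L 2 <= <[c]> + lpow L 3)%VS.
  move/(subvP LE)/memv_addP=> [_ /vlineP[a ->] [l lL ->]].
  by exists a, l.
apply/prodsP => u w _ _; have [a [b [l [lL ->]]]] := gpq u.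
have [a' [b' [l' [lL' ->]]]] := gpq w.
have -> : (a *: p + b *: q + l) ** (a' *: p + b' *: q + l')
   = (a * b' - b * a') *: c +
     ((a *: p + b *: q) ** l' + l ** (a' *: p + b' *: q + l')).
  rewrite [LHS]smulDl [(_ + _) ** (_ + l')]smulDr -addrA; congr (_ + _).
  rewrite !smulE !smul_alt !scaler0 add0r addr0 !scalerA.
  by rewrite [q ** p]smulC scalerN -scalerBl.
apply: memv_add; first by rewrite memvZ ?memv_line.
by apply: rpredD; [apply: lpow_mulr | apply: lpow_mul].
Qed.

(** Here L^2 multiplies [c] into L^4, since [c c = 0] and L^2 = Fc + L^3. *)
Lemma generators_lpow3 v : v \in lpow L 3 ->
  exists a b l, l \in lpow L 4 /\ v = a *: (c ** p) + b *: (c ** q) + l.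
Proof.
suff LE : (lpow L 3 <= <[c ** p]> + <[c ** q]> + lpow L 4)%VS.
  case/(subvP LE)/memv_addP=> _ /memv_addP[_ /vlineP[a ->] [_ /vlineP[b ->] ->]].
  by case=> l lL ->; exists a, b, l.
apply/prodsP => u w /generators_lpow2[d [m [mL ->]]] _.
have [a [b [l [lL ->]]]] := gpq w.
have [d' [m' [mL' ->]]] := generators_lpow2 lL.
have -> : (d *: c + m) ** (a *: p + b *: q + (d' *: c + m'))
   = (d * a) *: (c ** p) + (d * b) *: (c ** q) +
     (d *: (c ** m') + m ** (a *: p + b *: q + (d' *: c + m'))).
  rewrite [LHS]smulDl [RHS]addrA; congr (_ + _); rewrite !smulE.
  by rewrite smul_alt scaler0 add0r !scalerDr !scalerA.
apply: memv_add; first by apply: memv_add; rewrite memvZ ?memv_line.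
by apply: rpredD; [apply: rpredZ; apply: lpow_mulr | apply: lpow_mul].
Qed.

End Layers.

Hypothesis L7 : lpow L 7 = 0%VS.

(** [(u v, w) = - (u w, v)] pairs L^5 with L^3. *)
Lemma tri_lpow43 u v w : u \in lpow L 4 -> v \in lpow L 3 ->
  sform (u ** v) w = 0.
Proof.
move=> uL vL; rewrite tri_swap23 (lpow_orth (i := 4) (j := 2) L7) ?oppr0 //.
exact: lpow_mul.
Qed.

(** Its value at [w = p q] is the quantity that separates the algebras of the
    family: it is of degree 4 in [p] and in [q]. *)
Definition gen_tri p q w := sform ((p ** q ** p) ** (p ** q ** q)) w.

Lemma gen_triD p q u v : gen_tri p q (u + v) = gen_tri p q u + gen_tri p q v.
Proof. exact: sformDr. Qed.
Lemma gen_triZ p q a u : gen_tri p q (a *: u) = a * gen_tri p q u.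
Proof. exact: sformZr. Qed.

Section GenTri.
Variables p q : L.
Hypothesis gpq : generators p q.

Local Notation c := (p ** q).

(** T vanishes on L^4 x L^3 x L, and [c p], [c q] span L^3 modulo L^4: on
    L^3 x L^3 the alternating map T is a determinant times its value at
    [(c p, c q)]. *)
Lemma tri_lpow33 u v : u \in lpow L 3 -> v \in lpow L 3 ->
  exists a, forall w, sform (u ** v) w = a * gen_tri p q w.
Proof.
case/(generators_lpow3 gpq)=> a [b [l [lL ->]]].
case/(generators_lpow3 gpq)=> a' [b' [l' [lL' ->]]].
exists (a * b' - b * a') => w.
rewrite !smulE !sformE !tri_diag12 !(tri_lpow43 _ lL) ?mul_mul_lpow3 //;
  last exact: lpow_decr.
rewrite ![sform (_ ** l') w]tri_swap12 !(tri_lpow43 _ lL') ?mul_mul_lpow3 //.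
rewrite [sform (c ** q ** (c ** p)) w]tri_swap12 /gen_tri; ring.
Qed.

Lemma gen_tri_lpow3 w : w \in lpow L 3 -> gen_tri p q w = 0.
Proof.
case/(generators_lpow3 gpq)=> a [b [l [lL ->]]].
rewrite /gen_tri !sformE tri_diag13 tri_diag23 tri_swap23 tri_swap12.
by rewrite tri_swap23 tri_lpow43 ?mul_mul_lpow3 // !mulr0 !oppr0 !addr0.
Qed.

(** If it were zero then T would vanish on L^3 x L^3 x L^2, that is, L^3L^3
    would be orthogonal to L^2, hence central. *)
Lemma gen_tri_neq0 : ~~ (prods (lpow L 3) (lpow L 3) <= center_saa L)%VS ->
  gen_tri p q c != 0.
Proof.
apply: contra => /eqP t0; apply/prodsP => u v uL vL.
apply/mem_center_orth => w /(generators_lpow2 gpq)[g [l [lL ->]]].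
have [a ->] := tri_lpow33 uL vL.
by rewrite gen_triD gen_triZ t0 gen_tri_lpow3 // !mulr0 addr0 mulr0.
Qed.

(** A translation of [p] and [q] by elements of L^2 changes [c] by an element of
    L^3, and [c p], [c q] by elements of L^4; T vanishes on L^4 x L^3 x L. *)
Lemma gen_tri_shift u v w : u \in lpow L 2 -> v \in lpow L 2 ->
  gen_tri (p + u) (q + v) w = gen_tri p q w.
Proof.
move=> uL vL.
have cE : (p + u) ** (q + v) = c + (p ** v + u ** (q + v)).
  by rewrite smulDl smulDr addrA.
set d := p ** v + _ in cE.
have dL : d \in lpow L 3 by apply: rpredD; [apply: lpow_mulr | apply: lpow_mul].
have c2 x : x \in lpow L 2 -> c ** x \in lpow L 4.
  case/(generators_lpow2 gpq)=> a [l [lL ->]].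
  by rewrite smulDr smulZr smul_alt scaler0 add0r lpow_mulr.
rewrite /gen_tri cE.
have E x y : x \in lpow L 2 ->
    exists2 l, l \in lpow L 4 & (c + d) ** (y + x) = c ** y + l.
  move=> xL; exists (c ** x + d ** (y + x)).
    by apply: rpredD; [apply: c2 | apply: lpow_mul].
  by rewrite smulDl smulDr addrA.
have [l lL ->] := E u p uL; have [l' lL' ->] := E v q vL.
rewrite !smulE !sformE !(tri_lpow43 _ lL) ?mul_mul_lpow3 //;
  last exact: lpow_decr.
rewrite !addr0 [sform (_ ** l') w]tri_swap12 (tri_lpow43 _ lL') //;
  last exact: mul_mul_lpow3.
by rewrite oppr0 addr0.
Qed.

End GenTri.
End Generators.

(** * Normalising the generators *)

Section Adjust.
Variables (F : fieldType) (L : saa F).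
Implicit Types (a b : F) (p q u v w : L).
Hypothesis L7 : lpow L 7 = 0%VS.

Lemma generatorsZ p q a : a != 0 -> generators p q -> generators (a *: p) q.
Proof.
move=> a0 gpq v; have [d [e [l [lL ->]]]] := gpq v.
by exists (d / a), e, l; rewrite scalerA divfK.
Qed.

Lemma gen_tri_shift_self p q u v : generators p q ->
  u \in lpow L 2 -> v \in lpow L 2 ->
  gen_tri (p + u) (q + v) ((p + u) ** (q + v)) = gen_tri p q (p ** q).
Proof.
move=> gpq uL vL; rewrite gen_tri_shift // smulDl smulDr -addrA gen_triD.
rewrite [X in _ + X]gen_tri_lpow3 ?addr0 //.
by apply: rpredD; [apply: lpow_mulr | apply: lpow_mul].
Qed.

Definition admissible p q := generators p q /\ gen_tri p q (p ** q) != 0.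

Lemma admissible_shift p q u v : admissible p q ->
  u \in lpow L 2 -> v \in lpow L 2 -> admissible (p + u) (q + v).
Proof.
by move=> [gpq t0] uL vL; split; rewrite ?gen_tri_shift_self //;
   apply: generators_shift.
Qed.

(** Adding [k c] to [p] adds [k T(cp, cq, c)] to [T(cp, cq, p)], and likewise
    for [q]. *)
Lemma adjust_gen_tri p q : admissible p q -> exists p' q',
  [/\ admissible p' q', gen_tri p' q' p' = 0 & gen_tri p' q' q' = 0].
Proof.
move=> Apq; have [gpq t0] := Apq.
pose t := gen_tri p q (p ** q).
have cL a : a *: (p ** q) \in lpow L 2 by rewrite rpredZ // mul_lpow2.
exists (p + (- gen_tri p q p / t) *: (p ** q)).
exists (q + (- gen_tri p q q / t) *: (p ** q)).
split; first exact: admissible_shift.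
all: by rewrite gen_tri_shift // gen_triD gen_triZ divfK // subrr.
Qed.

(** Adding [a cp] to [p] changes [c p] by [a (c (cp))] modulo L^5, and [c q] by
    an element of L^5.  As L^5 is orthogonal to L^3, the value [(cp, cq)]
    increases by [a (c (cp), cq) = a T(cp, cq, c)]. *)
Lemma adjust_orth p q : admissible p q ->
  gen_tri p q p = 0 -> gen_tri p q q = 0 ->
  exists p',
  [/\ admissible p' q, gen_tri p' q p' = 0, gen_tri p' q q = 0 &
      sform (p' ** q ** p') (p' ** q ** q) = 0].
Proof.
move=> Apq Xp Xq; have [gpq t0] := Apq.
pose cp := p ** q ** p; pose cq := p ** q ** q; pose t := gen_tri p q (p ** q).
pose a := - sform cp cq / t; pose u := a *: cp.
have uL3 : u \in lpow L 3 by rewrite rpredZ // mul_mul_lpow3.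
have uL : u \in lpow L 2 by apply: lpow_decr.
have L0 : 0 \in lpow L 2 by apply: mem0v.
have XE w : gen_tri (p + u) q w = gen_tri p q w.
  by rewrite -[in LHS](addr0 q) gen_tri_shift.
exists (p + u); split; rewrite ?XE //.
- by rewrite -(addr0 q); apply: admissible_shift.
- by rewrite gen_triD Xp add0r gen_tri_lpow3.
pose l := u ** q; have lL : l \in lpow L 4 by apply: lpow_mul.
have -> : (p + u) ** q = p ** q + l by rewrite smulDl.
have O53 x y : x \in lpow L 5 -> y \in lpow L 3 -> sform x y = 0.
  exact: (lpow_orth (i := 4) (j := 2) L7).
have L34 x y : y \in lpow L 3 -> x ** y \in lpow L 4 by apply: lpow_mulr.
have lw w : l ** w \in lpow L 5 by apply: lpow_mul.
have -> : (p ** q + l) ** (p + u) = cp + p ** q ** u + l ** (p + u).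
  by rewrite smulDl smulDr.
have -> : (p ** q + l) ** q = cq + l ** q by rewrite smulDl.
have cqL : cq \in lpow L 3 by apply: mul_mul_lpow3.
have cpL : cp \in lpow L 3 by apply: mul_mul_lpow3.
have lqL3 : l ** q \in lpow L 3 by do 2!apply: lpow_decr.
rewrite sformDl (O53 _ _ (lw _)) ?rpredD // addr0 sformDr.
rewrite [sform _ (l ** q)]sformC (O53 _ _ (lw _)); last first.
  by rewrite rpredD // lpow_decr // L34.
rewrite oppr0 addr0 sformDl smulZr sformZl.
have -> : sform (p ** q ** cp) cq = t.
  by rewrite sform_smul /t /gen_tri.
by rewrite divfK // subrr.
Qed.

(** A central [z] can be added to [p] without changing any product, and it can
    be chosen with [(z, q) <> 0] because [q] is not in L^2, the orthogonal of
    the center.  Isotropy puts [z] in L^2. *)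
Lemma adjust_form p q : isotropic (center_saa L) ->
  admissible p q -> gen_tri p q p = 0 -> gen_tri p q q = 0 ->
  sform (p ** q ** p) (p ** q ** q) = 0 ->
  exists p',
  [/\ admissible p' q, gen_tri p' q p' = 0, gen_tri p' q q = 0,
      sform (p' ** q ** p') (p' ** q ** q) = 0 & sform p' q = 0].
Proof.
move=> Zi Apq Xp Xq Opq; have [gpq t0] := Apq.
have qL : q \notin lpow L 2.
  apply: contra t0 => qL; apply/eqP; apply: gen_tri_lpow3 => //.
  exact: lpow_mulr.
have [z zL zq] := sform_separates qL.
have zZ : z \in center_saa L by apply/mem_center_orth.
pose u := - sform p q *: z.
have uZ : u \in center_saa L by rewrite rpredZ.
have u0 w : u ** w = 0 by apply/(mem_center_saa _ uZ).
have uL : u \in lpow L 2.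
  by apply: mem_lpow2_orth => z' z'Z; apply: Zi.
have L0 : 0 \in lpow L 2 by apply: mem0v.
have E : (p + u) ** q = p ** q by rewrite smulDl u0 addr0.
have E' w : w ** (p + u) = w ** p.
  by rewrite smulDr [w ** u]smulC u0 oppr0 addr0.
have XE w : gen_tri (p + u) q w = gen_tri p q w by rewrite /gen_tri E E'.
exists (p + u); split; rewrite ?XE //.
- by rewrite -[q]addr0; apply: admissible_shift.
- by rewrite gen_triD Xp add0r /gen_tri -sform_smul u0 sform0l.
- by rewrite E E'.
- by rewrite sformDl sformZl zq mulr1 subrr.
Qed.

End Adjust.

(** * Recognising a presentation *)

Lemma sum_mul_eq (R : pzSemiRingType) (I : finType) (f : I -> R) (j : I) :
  \sum_i f i * (i == j)%:R = f j.
Proof.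
rewrite (bigD1 j) //= eqxx mulr1 big1 ?addr0 // => k /negPf ->.
by rewrite mulr0.
Qed.

Section StandardBases.
Variables (F : fieldType) (n : nat) (L : saa F).
Implicit Types (b : gen n -> L) (P : presentation F n).

(** Reduces a claim about an alternating map to increasing triples. *)
Lemma alt3_ind (T : eqType) (f : T -> nat) (Q : T -> T -> T -> Prop) :
  injective f ->
  (forall i j k, Q i j k -> Q j i k) -> (forall i j k, Q i j k -> Q i k j) ->
  (forall i k, Q i i k) ->
  (forall i j k, (f i < f j)%N -> (f j < f k)%N -> Q i j k) ->
  forall i j k, Q i j k.
Proof.
move=> fI Q12 Q23 Q11 Qs.
have Q13 i j k : Q i j k -> Q k j i by move/Q12/Q23/Q12.
have Q1 i j k : (f i < f j)%N -> Q i j k.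
  move=> ij; case: (ltngtP (f j) (f k)) => [jk | kj | /fI <-].
  - exact: Qs.
  - apply: Q23; case: (ltngtP (f i) (f k)) => [ik | ki | /fI <-] //.
    + exact: Qs.
    + by apply: Q12; apply: Qs.
  - by apply: Q13; apply: Q11.
move=> i j k; case: (ltngtP (f i) (f j)) => [|ji|/fI <-] //; first exact: Q1.
by apply: Q12; apply: Q1.
Qed.

Definition gen_code (k : gen n) : nat :=
  match k with inl i => i | inr i => n + i end.

Lemma gen_code_inj : injective gen_code.
Proof.
move=> [i|i] [j|j] /= => [/val_inj -> | E | E | /addnI/val_inj ->] //.
  by have := ltn_ord i; rewrite E ltnNge leq_addr.
by have := ltn_ord j; rewrite -E ltnNge leq_addr.
Qed.

Lemma satisfies_sorted b P :
  (forall i j k a, (i, j, k, a) \in P -> sform (b i ** b j) (b k) = a) ->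
  (forall i j k, (gen_code i < gen_code j)%N -> (gen_code j < gen_code k)%N ->
    ~~ listed P i j k -> sform (b i ** b j) (b k) = 0) ->
  satisfies b P.
Proof.
move=> PT P0; split=> //; apply: (alt3_ind gen_code_inj) => //.
- move=> i j k Q; rewrite tri_swap12 => nP; rewrite Q ?oppr0 //.
  apply: contra nP => /hasP[e eP ijk]; apply/hasP; exists e => //.
  by apply: perm_trans ijk; apply/permPl/(perm_catCA [:: j] [:: i]).
- move=> i j k Q; rewrite tri_swap23 => nP; rewrite Q ?oppr0 //.
  apply: contra nP => /hasP[e eP ijk]; apply/hasP; exists e => //.
  apply: perm_trans ijk; rewrite perm_cons.
  by apply/permPl/(perm_catC [:: k] [:: j]).
- by move=> i k _; rewrite tri_diag12.
Qed.

(** The Gram matrix of such a family is invertible, so the family is free. *)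
Lemma standard_basis_form b : \dim {:L} = (n + n)%N ->
  (forall i j, sform (b (inl i)) (b (inl j)) = 0) ->
  (forall i j, sform (b (inr i)) (b (inr j)) = 0) ->
  (forall i j, sform (b (inl i)) (b (inr j)) = (i == j)%:R) ->
  standard_basis b.
Proof.
move=> dL xx yy xy; split=> //.
have yx i j : sform (b (inr i)) (b (inl j)) = - (j == i)%:R.
  by rewrite sformC xy.
have sb : size (codom b) = (n + n)%N by rewrite size_codom card_sum card_ord.
rewrite basisEfree subvf sb dL leqnn !andbT.
suff : free (codom_tuple b) by [].
apply/freeP => c c0.
have {c0} : \sum_j c (enum_rank j) *: b j = 0.
  rewrite -[RHS]c0 (reindex _ (onW_bij _ (@enum_val_bij (gen n : finType)))) /=.
  apply: eq_bigr => i _; rewrite enum_valK; congr (_ *: _).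
  by rewrite nth_codom.
rewrite big_sumType /= => c0 i; rewrite -[i]enum_valK.
case: (enum_val i) => k; have /(congr1 (sform^~ _)) := c0.
- move/(_ (b (inr k))); rewrite sformDl sform0l !linear_sumlz /=.
  rewrite [X in _ + X]big1 => [|j _]; last by rewrite sformZl yy mulr0.
  under eq_bigr do rewrite sformZl xy.
  by rewrite addr0 (sum_mul_eq (fun k => c (enum_rank (inl k)))).
- move/(_ (b (inl k))); rewrite sformDl sform0l !linear_sumlz /=.
  rewrite big1 => [|j _]; last by rewrite sformZl xx mulr0.
  under eq_bigr do rewrite sformZl yx eq_sym mulrN.
  rewrite sumrN (sum_mul_eq (fun k => c (enum_rank (inr k)))) add0r.
  by move/eqP; rewrite oppr_eq0 => /eqP.
Qed.

End StandardBases.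

Local Notation i_ k := (@Ordinal 5 k isT).

(** The [inord] of [xg] and [yg] does not reduce, whereas concrete ordinals can
    be compared by computation. *)
Lemma inord5 : ((inord 0 = i_ 0) * (inord 1 = i_ 1) * (inord 2 = i_ 2) *
  (inord 3 = i_ 3) * (inord 4 = i_ 4))%type.
Proof. by do !split; apply: val_inj; rewrite /= inordK. Qed.

Lemma P10_22E (F : fieldType) (r : F) :
  P10_22 r = [:: (inl (i_ 2), inr (i_ 3), inr (i_ 4), r);
                 (inl (i_ 1), inr (i_ 2), inr (i_ 4), 1);
                 (inl (i_ 0), inr (i_ 2), inr (i_ 3), 1);
                 (inr (i_ 0), inr (i_ 1), inr (i_ 2), 1)].
Proof. by rewrite /P10_22 /xg /yg /= !inord5. Qed.

(** All the vectors of the basis are products of [y4] and [y5].  The values of T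
    with two entries among [y3], [y4], [y5], or with entries [y1] and [y2], are
    values of the form on the basis, through [y4 y3 = y1], [y5 y3 = y2],
    [y4 y5 = - r y3] and [y1 y2 = x3]; the other ones vanish because their
    entries lie deep enough in the lower central series. *)
Lemma presentation_of_generators (F : fieldType) (L : saa F) (r : F)
    (y3 y4 y5 : L) :
  let y1 := y4 ** y3 in let y2 := y5 ** y3 in let x3 := y1 ** y2 in
  lpow L 7 = 0%VS -> \dim {:L} = 10%N -> generators y4 y5 -> r != 0 ->
  y4 ** y5 = - r *: y3 ->
  sform y4 y5 = 0 -> sform y1 y2 = 0 ->
  sform x3 y3 = 1 -> sform x3 y4 = 0 -> sform x3 y5 = 0 ->
  has_presentation L (P10_22 r).
Proof.
move=> y1 y2 x3 L7 dL g45 r0 y45E s45 s12 x3y3 x3y4 x3y5.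
pose x1 := y2 ** y3; pose x2 := y3 ** y1.
pose x4 := - r^-1 *: (x3 ** y5); pose x5 := r^-1 *: (x3 ** y4).
have y3L : y3 \in lpow L 2.
  have -> : y3 = - r^-1 *: (y4 ** y5).
    by rewrite y45E scalerA mulrNN mulVf // scale1r.
  by rewrite rpredZ // mul_lpow2.
have y1L : y1 \in lpow L 3 by apply: lpow_mulr.
have y2L : y2 \in lpow L 3 by apply: lpow_mulr.
(* A product of elements of L^3 is a priori orthogonal to L^4 only, but
   T(y1, y2, -) also vanishes at y1 and y2, which span L^3 modulo L^4. *)
have x3_lpow3 w : w \in lpow L 3 -> sform x3 w = 0.
  have E v : y4 ** y5 ** v = r *: (v ** y3).
    by rewrite y45E smulZl smulC scalerN scaleNr opprK.
  have x3E : sform x3 w = r ^- 2 * gen_tri y4 y5 w.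
    by rewrite /gen_tri !E smulZl smulZr !sformZl /x3 /y1 /y2; field.
  by move=> wL; rewrite x3E gen_tri_lpow3 // mulr0.
have x3_mul v : v \in lpow L 2 -> x3 ** v = 0.
  move=> vL; apply: sform_nondeg => w.
  by rewrite sform_smul sformC x3_lpow3 ?oppr0 // lpow_mul.
have x3_mul_mul u w : x3 ** u ** w = 0.
  apply: sform_nondeg => v.
  rewrite sform_smul sformC tri_swap23 opprK x3_mul ?sform0l //.
  exact: mul_lpow2.
have x1L : x1 \in lpow L 4 by apply: lpow_mul.
have x2L : x2 \in lpow L 4 by apply: lpow_mulr.
have x3L : x3 \in lpow L 4 by apply: lpow_mul.
have tri34 v : sform (v ** y3) y4 = sform v y1.
  by rewrite sform_smul sformC smulC sformNr opprK.
have tri35 v : sform (v ** y3) y5 = sform v y2.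
  by rewrite sform_smul sformC smulC sformNr opprK.
have tri45 v : sform (v ** y4) y5 = r * sform v y3.
  by rewrite sform_smul sformC y45E sformZr mulNr opprK.
have y13 : sform y1 y3 = 0 by apply: tri_diag23.
have y14 : sform y1 y4 = 0 by apply: tri_diag13.
have y23 : sform y2 y3 = 0 by apply: tri_diag23.
have y25 : sform y2 y5 = 0 by apply: tri_diag13.
have y15 : sform y1 y5 = 0.
  by rewrite tri_swap23 y45E sformZl sform_alt mulr0 oppr0.
have y24 : sform y2 y4 = 0.
  by rewrite -sform_smul y45E sformZl sform_alt mulr0.
have y34 : sform y3 y4 = 0.
  have := tri_diag13 y4 y5; rewrite y45E sformZl => /eqP.
  by rewrite mulf_eq0 oppr_eq0 (negPf r0) => /eqP.
have y35 : sform y3 y5 = 0.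
  have := tri_diag23 y4 y5; rewrite y45E sformZl => /eqP.
  by rewrite mulf_eq0 oppr_eq0 (negPf r0) => /eqP.
pose X := [:: x1; x2; x3; x4; x5]; pose Y := [:: y1; y2; y3; y4; y5].
pose b (k : gen 5) : L := match k with inl i => X`_i | inr i => Y`_i end.
have ord5 (P : nat -> Prop) : P 0%N -> P 1%N -> P 2%N -> P 3%N -> P 4%N ->
    forall i : 'I_5, P i.
  by move=> P0 P1 P2 P3 P4 [[|[|[|[|[|i]]]]] ltiM].
have XL i : b (inl i) \in lpow L 4.
  apply: (ord5 (fun i => X`_i \in lpow L 4)) i => //=;
    by [apply: lpow_mul | apply: lpow_mulr
       | rewrite rpredZ //; apply: lpow_decr; apply: lpow_mul].
have x1y : forall j : 'I_5, sform x1 Y`_j = (0%N == j)%:R.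
  apply: (ord5 (fun j => sform x1 Y`_j = (0%N == j)%:R)) => /=.
  - by rewrite -sform_smul.
  - exact: tri_diag13.
  - exact: tri_diag23.
  - by rewrite tri34 sformC s12 oppr0.
  - by rewrite tri35 sform_alt.
have x2y : forall j : 'I_5, sform x2 Y`_j = (1%N == j)%:R.
  apply: (ord5 (fun j => sform x2 Y`_j = (1%N == j)%:R)) => /=.
  - exact: tri_diag23.
  - by rewrite sform_smul.
  - exact: tri_diag13.
  - by rewrite tri_swap12 tri34 sform_alt oppr0.
  - by rewrite tri_swap12 tri35 s12 oppr0.
have x3y : forall j : 'I_5, sform x3 Y`_j = (2%N == j)%:R.
  by apply: (ord5 (fun j => sform x3 Y`_j = (2%N == j)%:R)) => //=;
     apply: x3_lpow3.
have x3yv y v : v \in lpow L 2 -> sform (x3 ** y) v = 0.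
  by move=> vL; rewrite tri_swap23 x3_mul // sform0l oppr0.
have x4y : forall j : 'I_5, sform x4 Y`_j = (3%N == j)%:R.
  apply: (ord5 (fun j => sform x4 Y`_j = (3%N == j)%:R)) => /=; rewrite sformZl;
    do ?by rewrite x3yv ?mulr0 // lpow_decr.
  - by rewrite tri_swap23 tri45 x3y3 mulr1 mulrNN mulVf.
  - by rewrite tri_diag23 mulr0.
have x5y : forall j : 'I_5, sform x5 Y`_j = (4%N == j)%:R.
  apply: (ord5 (fun j => sform x5 Y`_j = (4%N == j)%:R)) => /=; rewrite sformZl;
    do ?by rewrite x3yv ?mulr0 // lpow_decr.
  - by rewrite tri_diag23 mulr0.
  - by rewrite tri45 x3y3 mulr1 mulVf.
have xyE : forall i j : 'I_5, sform X`_i Y`_j = (i == j)%:R.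
  move=> i j; rewrite -val_eqE; move: j.
  by apply: (ord5 (fun i => forall j : 'I_5,
    sform X`_i Y`_j = (i == j)%:R)) i.
have bS : standard_basis b.
  apply: standard_basis_form => // [i j|].
    by apply: (lpow_orth (i := 3) (j := 3) L7).
  pose S (u v : L) := sform u v = 0; rewrite -/(S _ _).
  have SC u v : S u v -> S v u by move=> uv; rewrite /S sformC uv oppr0.
  apply: (ord5 (fun i => forall j : 'I_5, S Y`_i Y`_j));
    by apply: (ord5 (fun j => S _ Y`_j)) => //=; try apply: SC;
       try apply: sform_alt.
exists b; split=> //.
rewrite P10_22E; apply: satisfies_sorted.
  move=> i j k a; rewrite !inE => /or4P[]/eqP[-> -> -> ->] /=.
  - by rewrite tri45 x3y3 mulr1.
  - by rewrite tri35 (x2y (i_ 1)).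
  - by rewrite tri34 (x1y (i_ 0)).
  - exact: x3y3.
have no_lt i (j : 'I_5) : (5 + i < j)%N = false.
  by apply/negbTE; rewrite -leqNgt (leq_trans (ltnW (ltn_ord j))) ?leq_addr.
have x4mul w : x4 ** w = 0 by rewrite smulZl x3_mul_mul scaler0.
have x5mul w : x5 ** w = 0 by rewrite smulZl x3_mul_mul scaler0.
have [x1y2 x1y3] : sform x1 y2 = 0 /\ sform x1 y3 = 0.
  by rewrite (x1y (i_ 1)) (x1y (i_ 2)).
have [x2y1 x2y3] : sform x2 y1 = 0 /\ sform x2 y3 = 0.
  by rewrite (x2y (i_ 0)) (x2y (i_ 2)).
have y21 : sform y2 y1 = 0 by rewrite sformC s12 oppr0.
case=> i [] j [] k; rewrite /gen_code ?no_lt //.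
(* With two entries among the x's, T is taken on L^4 x L^4 x L. *)
1,2: by move=> _ _ _; apply: tri_lpow43; rewrite ?XL // lpow_decr ?XL.
all: rewrite ltn_add2l; case: i => [[|[|[|[|[|i]]]]] ?] //;
  case: j => [[|[|[|[|[|j]]]]] ?] //; case: k => [[|[|[|[|[|k]]]]] ?] // _ _;
  rewrite /b /=; (try by []); move=> _.
(* x4 and x5 are central, x3 annihilates L^2, T vanishes on L^4 x L^3 x L. *)
all: try by rewrite ?x4mul ?x5mul ?sform0l.
all: try by rewrite x3_mul ?sform0l // lpow_decr.
all: try by apply: tri_lpow43.
(* The remaining values are values of the form on the basis. *)
all: by rewrite ?tri34 ?tri35 ?tri45 ?x1y2 ?x1y3 ?x2y1 ?x2y3 ?s12 ?y13 ?y23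
  ?y21 ?sform_alt ?mulr0 ?x3y4 ?x3y5.
Qed.

Lemma has_presentation_P10_22 (F : fieldType) (L : saa F) :
  \dim {:L} = 10%N -> isotropic (center_saa L) -> \dim (center_saa L) = 2%N ->
  lpow L 7 = 0%VS ->
  ~~ (prods (lpow L 3) (lpow L 3) <= center_saa L)%VS ->
  exists2 r : F, r != 0 & has_presentation L (P10_22 r).
Proof.
move=> dL Zi dZ L7 L33; have [p0 [q0 g0]] := center_generators dZ.
have A0 : admissible p0 q0 by split; last exact: gen_tri_neq0.
have [p1 [q [A1 X1p X1q]]] := adjust_gen_tri L7 A0.
have [p2 [A2 X2p X2q O2]] := adjust_orth L7 A1 X1p X1q.
have [p [[g t0] Xp Xq O S]] := adjust_form L7 Zi A2 X2p X2q O2.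
set c := p ** q in t0; set t := gen_tri p q c in t0.
(* With y4 = p / t, y5 = q and y3 = pq, the product y1y2 is (cp)(cq) / t and
   T(y1, y2, y3) is t / t = 1. *)
exists (- t^-1); first by rewrite oppr_eq0 invr_eq0.
have x3E w : sform ((t^-1 *: p) ** c ** (q ** c)) w = t^-1 * gen_tri p q w.
  rewrite smulZl [p ** c]smulC [q ** c]smulC smulZl !smulNl smulNr.
  by rewrite opprK sformZl.
apply: (presentation_of_generators (y3 := c) (y4 := t^-1 *: p) (y5 := q)) => //.
- by apply: generatorsZ; rewrite ?invr_eq0.
- by rewrite oppr_eq0 invr_eq0.
- by rewrite opprK smulZl.
- by rewrite sformZl S mulr0.
- rewrite smulZl sformZl [p ** c]smulC [q ** c]smulC sformNl sformNr opprK.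
  by rewrite O mulr0.
- by rewrite x3E mulVf.
- by rewrite x3E gen_triZ Xp !mulr0.
- by rewrite x3E Xq mulr0.
Qed.

(** * The coordinate algebra of a presentation *)

Section Model.
Variables (F : fieldType) (n : nat) (P : presentation F n).
Local Notation V := {ffun gen n -> F^o}.
Implicit Types (u v w : V) (k : gen n).

Definition model_form u v : F :=
  \sum_i (u (inl i) * v (inr i) - u (inr i) * v (inl i)).

Definition delta k : V := [ffun i => (i == k)%:R].

(** The vector [d] for which [(d, w)] is the coordinate of [w] at [k]. *)
Definition dual k : V :=
  match k with inl i => - delta (inr i) | inr i => delta (inl i) end.

Definition minor2 (i j : gen n) u v : F := u i * v j - u j * v i.

Definition minor3 (i j k : gen n) u v w : F :=
  minor2 i j u v * w k + minor2 j k u v * w i + minor2 k i u v * w j.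

(** The bilinear map that represents, through the form, [e.2] times the
    trilinear determinant in the three coordinates named by [e]. *)
Definition entry_mul (e : gen n * gen n * gen n * F) u v : V :=
  let i := e.1.1.1 in let j := e.1.1.2 in let k := e.1.2 in
  e.2 *: (minor2 i j u v *: dual k + minor2 j k u v *: dual i
          + minor2 k i u v *: dual j).

Definition model_mul u v : V := \sum_(e <- P) entry_mul e u v.

Lemma model_form_bilinear : bilinear_for *%R *%R model_form.
Proof.
by split=> z a u v /=; rewrite /model_form mulr_sumr -big_split /=;
  apply: eq_bigr => i _; rewrite !ffunE /GRing.scale /=; ring.
Qed.

HB.instance Definition _ :=
  bilinear_isBilinear.Build F V V F _ _ model_form model_form_bilinear.

Lemma model_mul_bilinear : bilinear_for *:%R *:%R model_mul.
Proof.
by split=> z a u v /=; rewrite /model_mul scaler_sumr -big_split /=;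
  apply: eq_bigr => e _; apply/ffunP => k;
  rewrite /entry_mul /minor2 !ffunE /GRing.scale /=; ring.
Qed.

HB.instance Definition _ :=
  bilinear_isBilinear.Build F V V V _ _ model_mul model_mul_bilinear.

Lemma model_form_dual k w : model_form (dual k) w = w k.
Proof.
rewrite /model_form; case: k => k /=.
  rewrite -[RHS](sum_mul_eq (fun i => w (inl i))); apply: eq_bigr => i _.
  by rewrite !ffunE /=; ring.
rewrite -[RHS](sum_mul_eq (fun i => w (inr i))); apply: eq_bigr => i _.
by rewrite !ffunE /=; ring.
Qed.

Lemma model_formC u v : model_form u v = - model_form v u.
Proof. by rewrite /model_form -sumrN; apply: eq_bigr => i _; ring. Qed.

Lemma model_form_alt u : model_form u u = 0.
Proof. by rewrite /model_form big1 // => i _; ring. Qed.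

Lemma model_form_nondeg u : (forall v, model_form u v = 0) -> u = 0.
Proof.
move=> u0; apply/ffunP => k.
by rewrite -model_form_dual model_formC u0 oppr0 ffunE.
Qed.

Lemma model_mul_alt u : model_mul u u = 0.
Proof.
rewrite /model_mul big1 // => e _; apply/ffunP => k.
by rewrite /entry_mul /minor2 !ffunE /GRing.scale /=; ring.
Qed.

Lemma model_tri u v w : model_form (model_mul u v) w =
  \sum_(e <- P) e.2 * minor3 e.1.1.1 e.1.1.2 e.1.2 u v w.
Proof.
rewrite linear_sumlz; apply: eq_bigr => e _.
by rewrite /entry_mul linearZl_LR !linearDl !linearZl_LR /= !model_form_dual.
Qed.

Lemma model_tri_cyc u v w :
  model_form (model_mul u v) w = model_form (model_mul v w) u.
Proof.
rewrite !model_tri; apply: eq_bigr => e _; congr (_ * _).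
by rewrite /minor3 /minor2; ring.
Qed.

Definition model : saa F := @SAA F V model_form model_mul
  model_form_alt model_form_nondeg model_mul_alt model_tri_cyc.

Lemma dim_model : \dim {:model} = (n + n)%N.
Proof. by rewrite dimvf /dim /= muln1 card_sum card_ord. Qed.

Lemma model_standard : standard_basis (delta : gen n -> model).
Proof.
have yE i : delta (inr i) = - dual (inl i) by rewrite /= opprK.
apply: standard_basis_form; first exact: dim_model.
- by move=> i j; rewrite [LHS](model_form_dual (inr i)) ffunE.
- move=> i j; rewrite yE sformNl [X in - X](model_form_dual (inl i)).
  by rewrite ffunE oppr0.
- by move=> i j; rewrite [LHS](model_form_dual (inr i)) ffunE.
Qed.

(** Each of the six terms of the determinant is zero unless the indices match. *)
Lemma minor3_delta (a b c i j k : gen n) :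
  ~~ perm_eq [:: i; j; k] [:: a; b; c] ->
  minor3 a b c (delta i) (delta j) (delta k) = 0.
Proof.
rewrite perm_sym => nP.
have N a' b' c' : perm_eq [:: a'; b'; c'] [:: a; b; c] ->
    delta i a' * delta j b' * delta k c' = 0.
  move=> E; rewrite !ffunE; case: eqP => [ai|]; last by rewrite !mul0r.
  case: eqP => [bj|]; last by rewrite mulr0 mul0r.
  case: eqP => [ck|]; last by rewrite mulr0.
  by case/negP: nP; rewrite perm_sym -ai -bj -ck.
have -> : forall u v w, minor3 a b c u v w =
    (u a * v b * w c - u b * v a * w c) + (u b * v c * w a - u c * v b * w a)
    + (u c * v a * w b - u a * v c * w b).
  by move=> u v w; rewrite /minor3 /minor2; ring.
rewrite (N a b c) // (N b a c) ?(N b c a) ?(N c b a) ?(N c a b) ?(N a c b).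
- by rewrite !subrr !addr0.
all: by apply/permP => x /=; ring.
Qed.

Lemma model_unlisted i j k : ~~ listed P i j k ->
  sform (smul (delta i : model) (delta j)) (delta k : model) = 0.
Proof.
move=> nP; rewrite [LHS]model_tri big_seq big1 // => e eP.
rewrite minor3_delta ?mulr0 //; apply: contra nP => ijk.
by apply/hasP; exists e.
Qed.

End Model.

(** * Isomorphisms within the family *)

Lemma satisfies_P10_22 (F : fieldType) (L : saa F) (b : gen 5 -> L) (r : F) :
  (forall i j k, ~~ listed (P10_22 r) i j k -> sform (b i ** b j) (b k) = 0) ->
  sform (b (xg 3) ** b (yg 4)) (b (yg 5)) = r ->
  sform (b (xg 2) ** b (yg 3)) (b (yg 5)) = 1 ->
  sform (b (xg 1) ** b (yg 3)) (b (yg 4)) = 1 ->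
  sform (b (yg 1) ** b (yg 2)) (b (yg 3)) = 1 ->
  satisfies b (P10_22 r).
Proof.
move=> b0 b1 b2 b3 b4; split=> // i j k a; rewrite !inE.
by case/or4P=> /eqP[-> -> -> ->].
Qed.

Lemma model_presentation (F : fieldType) (r : F) :
  has_presentation (model (P10_22 r)) (P10_22 r).
Proof.
exists (@delta F 5); split; first exact: model_standard.
apply: satisfies_P10_22; first exact: model_unlisted.
all: rewrite [LHS]model_tri /P10_22 /xg /yg /= !inord5 !big_cons big_nil.
all: rewrite /minor3 /minor2 !ffunE /=; ring.
Qed.

Lemma standard_basis_rescale (F : fieldType) n (L : saa F) (b : gen n -> L)
    (eta : 'I_n -> F) : (forall i, eta i != 0) -> standard_basis b ->
  standard_basis (fun k : gen n => match k with
    inl i => (eta i)^-1 *: b (inl i) | inr i => eta i *: b (inr i) end).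
Proof.
move=> eta0 [bB bE]; apply: standard_basis_form => [|i j|i j|i j].
- by rewrite (size_basis bB) card_sum card_ord.
- by rewrite sformZl sformZr; have [-> _ _] := bE i j; rewrite !mulr0.
- by rewrite sformZl sformZr; have [_ -> _] := bE i j; rewrite !mulr0.
- rewrite sformZl sformZr; have [_ _ ->] := bE i j.
  by case: eqP => [->|_]; rewrite !(mulr0, mulr1) // mulVf.
Qed.

(** The y's are multiplied by a^2, 1/a, 1/a, a^3, 1 and the x's divided by the
    same scalars.  Over the three listed triples of value 1 the product of the
    scalars is 1, and over x3, y4, y5 it is a * a^3 * 1 = a^4. *)
Lemma has_presentation_rescale (F : fieldType) (L : saa F) (r a : F) :
  a != 0 -> has_presentation L (P10_22 r) ->
  has_presentation L (P10_22 (r * a ^+ 4)).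
Proof.
move=> a0 [b [bS [bP b0]]].
pose e : seq F := [:: a ^+ 2; a^-1; a^-1; a ^+ 3; 1].
have e0 (i : 'I_5) : e`_i != 0.
  by case: i => [[|[|[|[|[|i]]]]] ?] //=;
     rewrite ?expf_neq0 ?invr_eq0 ?oner_eq0.
exists (fun k : gen 5 => match k with
  inl i => (e`_i)^-1 *: b (inl i) | inr i => e`_i *: b (inr i) end).
split; first exact: (standard_basis_rescale (eta := fun i : 'I_5 => e`_i)).
apply: satisfies_P10_22.
  move=> i j k nP; have /b0 T0 : ~~ listed (P10_22 r) i j k by [].
  by case: i j k T0 {nP} => [i|i] [j|j] [k|k] T0;
     rewrite !(smulE, sformE) T0 !mulr0.
all: rewrite /xg /yg /= !inord5 !(smulE, sformE) /=.
- rewrite (bP (inl (i_ 2)) (inr (i_ 3)) (inr (i_ 4)) r).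
    by field; rewrite a0 ?oner_neq0.
  by rewrite P10_22E !inE eqxx ?orbT.
- rewrite (bP (inl (i_ 1)) (inr (i_ 2)) (inr (i_ 4)) 1).
    by field; rewrite a0 ?oner_neq0.
  by rewrite P10_22E !inE eqxx ?orbT.
- rewrite (bP (inl (i_ 0)) (inr (i_ 2)) (inr (i_ 3)) 1).
    by field; rewrite a0 ?oner_neq0.
  by rewrite P10_22E !inE eqxx ?orbT.
- rewrite (bP (inr (i_ 0)) (inr (i_ 1)) (inr (i_ 2)) 1).
    by field; rewrite a0 ?oner_neq0.
  by rewrite P10_22E !inE eqxx ?orbT.
Qed.

(** A product has no coordinate at y4, y5; hence a product with a product has
    none at y3 either. *)
Lemma model_mul_y (F : fieldType) (r : F) (u v : {ffun gen 5 -> F^o}) :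
  let m := model_mul (P10_22 r) in
  [/\ m u v (yg 5) = 0, m u v (yg 4) = 0,
      m u v (yg 3) = - r * minor2 (yg 4) (yg 5) u v,
      m u v (yg 2) = - minor2 (yg 3) (yg 5) u v &
      m u v (yg 1) = - minor2 (yg 3) (yg 4) u v].
Proof.
by move=> m; split; rewrite /m /model_mul /P10_22 !big_cons
  big_nil /entry_mul /minor2 /xg /yg /= !inord5 !ffunE /GRing.scale /=; ring.
Qed.

(** The minor is the determinant of the coordinates of [p], [q] modulo L^2, and
    [- r] times it is the coordinate of [p q] at y3. *)
Lemma model_gen_tri (F : fieldType) (r : F) (p q : model (P10_22 r)) :
  gen_tri p q (p ** q) =
  - r ^+ 3 * (minor2 (yg 4) (yg 5) (p : {ffun gen 5 -> F^o}) q) ^+ 4.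
Proof.
pose m := model_mul (P10_22 r).
rewrite /gen_tri [LHS](_ : _ =
  model_form (m (m (m p q) p) (m (m p q) q)) (m p q)) //.
have [c5 c4 c3 _ _] := model_mul_y r p q.
have [u5 u4 u3 u2 u1] := model_mul_y r (m p q) p.
have [v5 v4 v3 v2 v1] := model_mul_y r (m p q) q.
rewrite model_tri /P10_22 !big_cons big_nil; cbv [fst snd].
rewrite /minor3 /minor2.
rewrite c5 c4 c3 u5 u4 u3 u2 u1 v5 v4 v3 v2 v1.
rewrite /minor2 c5 c4 c3 /minor2.
ring.
Qed.

Lemma isomorphic_gen_tri (F : fieldType) (L M : saa F) (p q : L) :
  isomorphic_saa L M -> exists p' q' : M,
  gen_tri p' q' (p' ** q') = gen_tri p q (p ** q).
Proof.
case=> f [_ fM fS]; exists (f p), (f q).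
by rewrite /gen_tri -!fM fS.
Qed.

Lemma isomorphic_refl (F : fieldType) (L : saa F) : isomorphic_saa L L.
Proof. by exists idfun; split=> //; exists idfun. Qed.

(** The pair (y4, y5) of the first algebra has determinant 1; its image in the
    second one has some determinant [D], and [gen_tri] is preserved. *)
Lemma model_isomorphic_pow4 (F : fieldType) (r s : F) : r != 0 -> s != 0 ->
  same_algebra (P10_22 r) (P10_22 s) -> exists2 a : F, a != 0 & s / r = a ^+ 4.
Proof.
move=> r0 s0 [L [M [Lr Ms LM]]].
have iso1 := has_presentation_unique (model_presentation r) Lr.
have iso2 := has_presentation_unique Ms (model_presentation s).
pose p0 : model (P10_22 r) := delta F (yg 4).
pose q0 : model (P10_22 r) := delta F (yg 5).
have [p1 [q1 t1]] := isomorphic_gen_tri p0 q0 iso1.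
have [p2 [q2 t2]] := isomorphic_gen_tri p1 q1 LM.
have [p [q t]] := isomorphic_gen_tri p2 q2 iso2.
move: t; rewrite t2 t1 !model_gen_tri.
have -> : @minor2 F 5 (yg 4) (yg 5) (delta F (yg 4)) (delta F (yg 5)) = 1.
  by rewrite /minor2 !ffunE /yg /= !inord5 /=; ring.
rewrite expr1n mulr1; set D := minor2 _ _ _ _ => t.
have D0 : D != 0.
  apply/eqP => D0; move/eqP: t; rewrite D0 expr0n /= mulr0 eq_sym oppr_eq0.
  by rewrite expf_eq0 (negPf r0).
exists (D * s / r); first by rewrite !mulf_neq0 ?invr_eq0.
have E : r ^+ 3 = s ^+ 3 * D ^+ 4 by apply: oppr_inj; rewrite -t mulNr.
apply: (mulfI (expf_neq0 4 r0)).
have -> : r ^+ 4 * (s / r) = s * r ^+ 3 by field.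
by rewrite E; field.
Qed.

Theorem proposition8p2 (F : fieldType) :
  (forall L : saa F,
      \dim {:L} = 10%N ->
      nilpotent_saa L ->
      isotropic (center_saa L) ->
      \dim (center_saa L) = 2%N ->
      nilpotence_class L 6 ->
      ~~ (prods (lpow L 3) (lpow L 3) <= center_saa L)%VS ->
      exists2 r : F, r != 0 & has_presentation L (P10_22 r)) /\
  (forall r s : F, r != 0 -> s != 0 ->
      (same_algebra (P10_22 r) (P10_22 s) <->
       exists2 a : F, a != 0 & s / r = a ^+ 4)).
Proof.
split=> [L dL _ Zi dZ [L7 _] L33 | r s r0 s0].
  exact: has_presentation_P10_22.
split; first exact: model_isomorphic_pow4.
case=> a a0 sr; have Mr := model_presentation r.
exists (model (P10_22 r)), (model (P10_22 r)); split=> //.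
  have -> : s = r * a ^+ 4 by rewrite -sr mulrC divfK.
  exact: has_presentation_rescale.
exact: isomorphic_refl.
Qed.
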